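(* Let $$\widetilde{\mathcal F}:=\{g\in L^2(D): g\le 0\ \text{a.e. in }E\}.$$ For each $g\in\widetilde{\mathcal F}$ there exists a sequence $\{g_m\}\subset\mathcal F_{\mathfrak s}\cap C^\infty(\overline D)$ such that $$g_m\to g\quad\text{in }L^2(D)\quad\text{as }m\to\infty.$$
   Context: $D\subset\mathbb{R}^2$ is a bounded domain of class $C^{1,1}$; $E\subset D$ is a domain with $\mathrm{dist}(\overline E,\partial D)>0$. The set of admissible shape functions is $$\mathcal F_{\mathfrak s}:=\{g\in C^2(\overline D): g(x)<0\ \forall x\in E,\ |\nabla g(x)|+|g(x)|>0\ \forall x\in D,\ g(x)>0\ \forall x\in\partial D\}.$$
   Formalization: It is additionally assumed that the boundary of E has Lebesgue measure zero; if it has positive measure the claim fails, since the indicator of the boundary of E lies in the set F-tilde but is not an L^2 limit of functions negative on E and continuous. *)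

(* Defs.v *)
From HB Require Import structures.
From mathcomp Require Import all_boot all_order all_algebra.
From mathcomp Require Import all_classical all_reals all_analysis.

Set Implicit Arguments.
Unset Strict Implicit.
Unset Printing Implicit Defensive.

Import Order.TTheory GRing.Theory Num.Theory.
Import numFieldNormedType.Exports.

Local Open Scope classical_set_scope.
Local Open Scope ring_scope.

Section plane.
Context {R : realType}.

(* The library's norm on [R * R] is the sup norm: it generates the right
   topology, but is not the norm of the Euclidean plane. *)
Definition enorm (x : R * R) : R := Num.sqrt (x.1 ^+ 2 + x.2 ^+ 2).

(* +oo when one of the two sets is empty *)
Definition set_dist (A B : set (R * R)) : \bar R :=
  ereal_inf [set (enorm (x - y))%:E | x in A & y in B].

Definition boundary (D : set (R * R)) : set (R * R) := closure D `\` D°.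

Definition domain (D : set (R * R)) : Prop :=
  [/\ D !=set0, open D & connected D].

(* Near each boundary point [p], in the orthonormal frame centred at [p] with
   axes [(c, s)] and [(- s, c)], [D] is the strict epigraph of a C^{1,1}
   function.  Allowing only rotations loses nothing: a reflection of the first
   axis is absorbed by [gam]. *)
Definition C11_boundary (D : set (R * R)) : Prop :=
  forall p, boundary D p ->
  exists (c s r : R) (gam : R -> R),
    [/\ c ^+ 2 + s ^+ 2 = 1, 0 < r,
        (forall t, derivable gam t 1) /\ lipschitz (derive1 gam)
      & forall x, enorm (x - p) < r ->
          (D x <-> gam (c * (x.1 - p.1) + s * (x.2 - p.2))
                   < - s * (x.1 - p.1) + c * (x.2 - p.2))].

(* C^k of the closure of the open set [D]: all partial derivatives of order at
   most [k] exist in [D] and extend continuously to [closure D].  The extended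
   first partial derivatives are [g1] and [g2]; the values of [g] outside
   [closure D] are irrelevant. *)
Fixpoint Ck_closure (k : nat) (D : set (R * R)) (g : R * R -> R) : Prop :=
  {within closure D, continuous g} /\
  if k is k'.+1 then
    exists g1 g2 : R * R -> R,
      [/\ forall x, D x -> is_derive x ((1, 0) : R * R) g (g1 x),
          forall x, D x -> is_derive x ((0, 1) : R * R) g (g2 x),
          Ck_closure k' D g1 & Ck_closure k' D g2]
  else True.

Definition Cinfty_closure (D : set (R * R)) (g : R * R -> R) : Prop :=
  forall k, Ck_closure k D g.

Definition grad (g : R * R -> R) (x : R * R) : R * R :=
  ('D_((1, 0) : R * R) g x, 'D_((0, 1) : R * R) g x).

Definition shape_functions (D E : set (R * R)) : set (R * R -> R) :=
  [set g | [/\ Ck_closure 2 D g,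
               forall x, E x -> g x < 0,
               forall x, D x -> 0 < enorm (grad g x) + `|g x|
             & forall x, boundary D x -> 0 < g x]].

(* [lebesgue_measure] lives on the alias [measurableTypeR R] of [R], so its
   square lives on the following alias of [R * R], with the Borel sets. *)
Local Notation mplane := (measurableTypeR R * measurableTypeR R)%type.

Definition plane_measure : {measure set mplane -> \bar R} :=
  (@lebesgue_measure R \x @lebesgue_measure R)%E.

(* A merely open connected [E] may have a boundary of positive area.  A
   continuous function that is negative on [E] is nonpositive on [closure E],
   so the indicator function of [boundary E], which vanishes on [E], would
   then not be an L^2 limit of shape functions. *)
Definition null_boundary (E : set (R * R)) : Prop :=
  plane_measure (boundary E : set mplane) = 0%E.

(* Functions are total, so [D]-supported integrals are taken through the
   extension by zero [g \_ D].  Elements of L^2 are represented by Borel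
   functions, not by almost-everywhere classes. *)
Definition L2 (D : set (R * R)) : set (R * R -> R) :=
  [set g | (g \_ D : mplane -> R) \in Lfun plane_measure 2%:E].

Definition cvg_L2 (D : set (R * R)) (gs : nat -> R * R -> R) (g : R * R -> R) :
    Prop :=
  (forall m, L2 D (gs m)) /\
  Lnorm plane_measure 2%:E (EFin \o ((gs m \- g) \_ D)) @[m --> \oo] --> 0%E.

Definition nonpos_L2 (D E : set (R * R)) : set (R * R -> R) :=
  [set g | L2 D g /\ {ae plane_measure, forall x : mplane, E x -> g x <= 0}].

End plane.

(* Main.v *)
Require Import Defs.
From mathcomp Require Import all_boot all_order all_algebra.
From mathcomp Require Import all_classical all_reals all_analysis.
From mathcomp Require Import measurable_realfun measurable_fun_approximation.
From mathcomp Require Import ring lra.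

Set Implicit Arguments.
Unset Strict Implicit.
Unset Printing Implicit Defensive.
Import Order.TTheory GRing.Theory Num.Theory.
Import numFieldNormedType.Exports.
Local Open Scope classical_set_scope.
Local Open Scope ring_scope.

(** Polynomials are smooth up to the boundary, and the polynomial shape
    functions are already dense.  Given [g], four approximations are composed.

    First, [g] is approximated in L^2 by a Lipschitz function [phi]
    ([lip_dense_L2]).  Indicators of open sets are limits of truncated multiples
    of a distance function, and Dynkin's theorem, applied to the pi-system of
    open sets, carries the density from them to all of L^2 ([sqdist_dense]).

    Next, [phi] is bent to the sign constraints ([lip_sign_constrained_approx]):
    it is cut down to [- n^-1] on [E] and lifted to [n^-1] on the boundary of
    [D], with two barriers of slope [n].  When [n] grows the result tends, off
    the null set [boundary E], to [phi] outside [E] and to [min phi 0] inside.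
    That limit is no farther from [g] than [phi] is, because [g <= 0] on [E].
    The two constraints are compatible since [E] and the boundary of [D] are at
    a positive distance.

    Then the resulting Lipschitz function, whose sign constraints now hold with
    a margin, is approximated uniformly on a square containing [D] by Bernstein
    polynomials ([lip_polyfun_approx]).

    Finally, the polynomial [p] is made nondegenerate by subtracting a small
    affine function ([polyfun_nondegenerate_approx]).  The difference of [p]
    and [b1 x + b2 y + b3] has a critical zero at [(x, y)] only if the triple
    [(b1, b2, b3)] is the value there of the map
    [(d1 p, d2 p, p - x d1 p - y d2 p)].  This map is Lipschitz from a square to
    a three-dimensional space, so its image misses points arbitrarily close to
    0 ([lip_image_misses_small_point]): this replaces Sard's theorem by a
    pigeonhole count. *)

(** * Squared L^2 distance *)

Section sqdist.
Context {d} {T : measurableType d} {R : realType} (mu : {measure set T -> \bar R}).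
Context (D : set T).
Implicit Types f g h : T -> R.

(** The square of the L^2 distance on [D]: its triangle inequality holds up to
    a factor 2, from [(a + b)^2 <= 2 (a^2 + b^2)], which is enough for density
    arguments. *)
Definition sqdist f g : \bar R := (\int[mu]_(x in D) ((f x - g x) ^+ 2)%:E)%E.

Context (mD : measurable D).

Lemma measurable_sqdist f g : measurable_fun D f -> measurable_fun D g ->
  measurable_fun D (EFin \o (fun x => (f x - g x) ^+ 2)).
Proof.
move=> mf mg; apply/measurable_EFinP.
by apply: measurable_funX; exact: measurable_funB.
Qed.

Lemma sqdist_ge0 f g : (0 <= sqdist f g)%E.
Proof. by apply: integral_ge0 => x _; rewrite lee_fin sqr_ge0. Qed.

Lemma sqdistC f g : sqdist f g = sqdist g f.
Proof. by apply: eq_integral => x _; rewrite -sqrrN opprB. Qed.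

Lemma sqdistxx f : sqdist f f = 0%E.
Proof. by apply: integral0_eq => x _; rewrite subrr expr0n. Qed.

Lemma sqdist_triangle f g h : measurable_fun D f -> measurable_fun D g ->
  measurable_fun D h ->
  (sqdist f h <= 2%:E * (sqdist f g + sqdist g h))%E.
Proof.
move=> mf mg mh.
have m1 := measurable_sqdist mf mg; have m2 := measurable_sqdist mg mh.
rewrite /sqdist -ge0_integralD//; try by move=> x _; rewrite lee_fin sqr_ge0.
rewrite -ge0_integralZl_EFin//; last 2 first.
- by move=> x _; rewrite adde_ge0// lee_fin sqr_ge0.
- exact: emeasurable_funD.
apply: ge0_le_integral => //.
- by move=> x _; rewrite lee_fin sqr_ge0.
- exact: measurable_sqdist.
- by apply: measurable_funeM; exact: emeasurable_funD.
move=> x _; rewrite -EFinD -EFinM lee_fin.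
have := sqr_ge0 ((f x - g x) - (g x - h x)); lra.
Qed.

Lemma sqdist_ae_le f g f' g' : measurable_fun D f -> measurable_fun D g ->
  measurable_fun D f' -> measurable_fun D g' ->
  {ae mu, forall x, D x -> `|f x - g x| <= `|f' x - g' x|} ->
  (sqdist f g <= sqdist f' g')%E.
Proof.
move=> mf mg mf' mg' H; apply: ae_ge0_le_integral => //.
- by move=> x _; rewrite lee_fin sqr_ge0.
- exact: measurable_sqdist.
- by move=> x _; rewrite lee_fin sqr_ge0.
- exact: measurable_sqdist.
apply: filterS H => x H Dx; rewrite lee_fin -real_normK ?num_real//.
by rewrite -[leRHS]real_normK ?num_real// lerXn2r ?nnegrE//; exact: H.
Qed.

Lemma sqdist_le_cst f g c : measurable_fun D f -> measurable_fun D g ->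
  (forall x, D x -> `|f x - g x| <= c) -> (sqdist f g <= (c ^+ 2)%:E * mu D)%E.
Proof.
move=> mf mg H; rewrite -(integral_cst mu mD (c ^+ 2)%:E).
apply: ge0_le_integral => //.
- by move=> x _; rewrite lee_fin sqr_ge0.
- exact: measurable_sqdist.
move=> x Dx; rewrite lee_fin -real_normK ?num_real//.
have h := H _ Dx; rewrite lerXn2r ?nnegrE//.
exact: le_trans h.
Qed.

Lemma sqdist_dominated (f_ : nat -> T -> R) f (b : T -> R) :
  (forall n, measurable_fun D (f_ n)) -> measurable_fun D f ->
  measurable_fun D b ->
  (sqdist b (cst 0%R) < +oo)%E ->
  (forall n x, D x -> `|f_ n x| <= b x) -> (forall x, D x -> `|f x| <= b x) ->
  {ae mu, forall x, D x -> f_ ^~ x @ \oo --> f x} ->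
  forall e : R, 0 < e -> \forall n \near \oo, (sqdist (f_ n) f <= e%:E)%E.
Proof.
move=> mf_ mf mb ib f_b fb f_f e e0.
have mb2 : measurable_fun D (EFin \o (fun x => 2 ^+ 2 * b x ^+ 2)).
  apply/measurable_EFinP; apply: measurable_funM => //.
  exact: measurable_funX.
have [_ _] : [/\ mu.-integrable D (cst 0%E),
  [sequence \int[mu]_(x in D) `|((f_ n x - f x) ^+ 2)%:E - 0| ]_n @ \oo --> 0 &
  [sequence \int[mu]_(x in D) ((f_ n x - f x) ^+ 2)%:E ]_n @ \oo -->
    \int[mu]_(x in D) (cst 0 x)]%E.
  apply: (dominated_convergence mD (g := EFin \o (fun x => 2 ^+ 2 * b x ^+ 2))).
  - by move=> n; exact: measurable_sqdist.
  - exact: measurable_cst.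
  - apply: filterS f_f => x /[apply] h.
    apply: cvg_EFin; first exact: nearW.
    have -> : (0 : R) = 0 * 0 by rewrite mulr0.
    under eq_fun do rewrite /= expr2.
    by rewrite /comp /=; apply: cvgM; rewrite -(subrr (f x)); apply: cvgB => //; exact: cvg_cst.
  - apply/integrableP; split => //.
    rewrite [ltLHS](_ : _ = \int[mu]_(x in D) ((2 ^+ 2)%:E * (b x ^+ 2)%:E))%E;
      last by apply: eq_integral => x _; rewrite /= ger0_norm// mulr_ge0// sqr_ge0.
    rewrite ge0_integralZl_EFin//.
    + rewrite lte_mul_pinfty// (le_lt_trans _ ib)//.
      by under [X in (_ <= X)%E]eq_integral => x _ do rewrite /cst subr0.
    + by move=> x _; rewrite lee_fin sqr_ge0.
    + by apply/measurable_EFinP; exact: measurable_funX.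
  apply: aeW => x n Dx; rewrite gee0_abs ?lee_fin ?sqr_ge0// -exprMn.
  rewrite -real_normK ?num_real// lerXn2r ?nnegrE ?mulr_ge0//.
    exact: le_trans (fb _ Dx).
  have := f_b n _ Dx; have := fb _ Dx.
  have := ler_normB (f_ n x) (f x); lra.
rewrite integral0 => /fine_cvgP[fi /cvgrPdist_le/(_ _ e0)] c.
near=> n.
have fin : sqdist (f_ n) f \is a fin_num by near: n.
have : `|0 - fine (sqdist (f_ n) f)| <= e by near: n.
rewrite sub0r normrN ger0_norm ?fine_ge0 ?sqdist_ge0// -lee_fin.
by rewrite fineK.
Unshelve. all: by end_near.
Qed.

End sqdist.

(** * Density in L^2 by Dynkin's theorem *)

Section density.
Context {d} {T : measurableType d} {R : realType} (mu : {measure set T -> \bar R}).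
Context (D : set T) (mD : measurable D) (muD : (mu D < +oo)%E).
Context (V : set (T -> R)) (G : set (set T)).
Hypothesis V_meas : forall f, V f -> measurable_fun setT f.
Hypothesis V_lin : forall a f g, V f -> V g -> V (fun x => a * f x + g x).
Hypothesis V_one : V (cst 1).
Hypothesis G_gen : @measurable _ T = <<s G >>.
Hypothesis G_setI : setI_closed G.
Hypothesis G_lim : forall U, G U -> exists f_ : nat -> T -> R,
  [/\ forall n, V (f_ n), forall n x, `|f_ n x| <= 1
    & forall x, f_ ^~ x @ \oo --> (\1_U x : R)].
Implicit Types f g : T -> R.

(* [f] lies in the L^2 closure of [V] *)
Let appr f := measurable_fun setT f /\
  forall e : R, 0 < e -> exists2 h, V h & (sqdist mu D f h <= e%:E)%E.

Let apprV f : V f -> appr f.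
Proof.
move=> Vf; split; first exact: V_meas.
by move=> e e0; exists f; rewrite // sqdistxx lee_fin ltW.
Qed.

Let apprD a f g : appr f -> appr g -> appr (fun x => a * f x + g x).
Proof.
move=> [mf Af] [mg Ag]; split.
  by apply: measurable_funD => //; exact: measurable_funM.
move=> e e0.
have a0 : 0 < 4 * (a ^+ 2 + 1) by rewrite mulr_gt0// ltr_wpDl// sqr_ge0.
have [h Vh fh] := Af (e / (4 * (a ^+ 2 + 1))) (divr_gt0 e0 a0).
have [k Vk gk] := Ag (e / 4) (divr_gt0 e0 (ltr0n _ 4)).
exists (fun x => a * h x + k x); first exact: V_lin.
have mh := V_meas Vh; have mk := V_meas Vk.
have mT f' : measurable_fun setT f' -> measurable_fun D f'.
  by move=> ?; exact: measurable_funTS.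
apply: (le_trans (@sqdist_triangle _ _ _ mu D mD _ (fun x => a * h x + g x) _ _ _ _)).
- by apply: mT; apply: measurable_funD => //; exact: measurable_funM.
- by apply: mT; apply: measurable_funD => //; exact: measurable_funM.
- by apply: mT; apply: measurable_funD => //; exact: measurable_funM.
rewrite [X in (_ * (X + _))%E](_ : _ = (a ^+ 2)%:E * sqdist mu D f h)%E; last first.
  rewrite -ge0_integralZl_EFin ?sqr_ge0//.
  - apply: eq_integral => x _; rewrite -EFinM; congr EFin; ring.
  - by move=> x _; rewrite lee_fin sqr_ge0.
  - by apply: measurable_sqdist; exact: mT.
rewrite [X in (_ * (_ + X))%E](_ : _ = sqdist mu D g k)%E; last first.
  by apply: eq_integral => x _; congr EFin; ring.
apply: (@le_trans _ _ (2%:E * ((a ^+ 2)%:E * (e / (4 * (a ^+ 2 + 1)))%:E + (e / 4)%:E)))%E.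
  rewrite lee_pmul2l//; apply: leeD => //.
  by apply: lee_wpmul2l => //; rewrite lee_fin sqr_ge0.
rewrite [leLHS](_ : _ = (2 * (a ^+ 2 * (e / (4 * (a ^+ 2 + 1))) + e / 4))%:E)//.
rewrite lee_fin.
have -> : a ^+ 2 * (e / (4 * (a ^+ 2 + 1))) = e / 4 * (a ^+ 2 / (a ^+ 2 + 1)).
  by field; rewrite gt_eqF// ltr_wpDl// sqr_ge0.
have : a ^+ 2 / (a ^+ 2 + 1) <= 1.
  by rewrite ler_pdivrMr ?ltr_wpDl ?sqr_ge0// mul1r lerDl.
have : 0 <= a ^+ 2 / (a ^+ 2 + 1).
  by rewrite divr_ge0 ?sqr_ge0// ler_wpDl// sqr_ge0.
by move: (a ^+ 2 / _) => u; nra.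
Qed.

Let appr_lim (f_ : nat -> T -> R) f (b : T -> R) :
  (forall n, appr (f_ n)) -> measurable_fun setT f ->
  measurable_fun setT b -> (sqdist mu D b (cst 0%R) < +oo)%E ->
  (forall n x, D x -> `|f_ n x| <= b x) -> (forall x, D x -> `|f x| <= b x) ->
  (forall x, D x -> f_ ^~ x @ \oo --> f x) -> appr f.
Proof.
move=> Af_ mf mb ib f_b fb f_f; split => // e e0.
have mT f' : measurable_fun setT f' -> measurable_fun D f'.
  by move=> ?; exact: measurable_funTS.
have e4 : 0 < e / 4 by rewrite divr_gt0.
have := @sqdist_dominated _ _ _ mu D mD f_ f b (fun n => mT _ (Af_ n).1)
  (mT _ mf) (mT _ mb) ib f_b fb (aeW _ f_f) _ e4.
move=> [n _ /(_ n (leqnn n))/= H].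
have [h Vh fh] := (Af_ n).2 _ e4.
exists h => //.
apply: (le_trans (@sqdist_triangle _ _ _ mu D mD _ (f_ n) _
  (mT _ mf) (mT _ (Af_ n).1) (mT _ (V_meas Vh)))).
rewrite sqdistC; apply: (@le_trans _ _ (2%:E * ((e/4)%:E + (e/4)%:E)))%E.
  by rewrite lee_pmul2l//; exact: leeD.
rewrite -EFinD -EFinM lee_fin; lra.
Qed.

Let sqdist1 : (sqdist mu D (cst 1%R) (cst 0%R) < +oo)%E.
Proof.
apply: le_lt_trans (@sqdist_le_cst _ _ _ mu D mD (cst 1) (cst 0) 1 _ _ _) _ => //.
- by move=> x _; rewrite subr0 normr1.
- by rewrite expr1n mul1e.
Qed.

Let appr_indic A : measurable A -> appr (\1_A).
Proof.
have norm1 (B : set T) x : `|\1_B x : R| <= 1.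
  by rewrite ger0_norm// indicE lern1 leq_b1.
have lim1 (f_ : nat -> T -> R) B : (forall n, appr (f_ n)) -> measurable B ->
    (forall n x, `|f_ n x| <= 1) -> (forall x, f_ ^~ x @ \oo --> (\1_B x : R)) ->
    appr (\1_B).
  move=> Af mB f1 fB; apply: (appr_lim (f_ := f_) (b := cst 1)) => //.
move=> mA; rewrite G_gen in mA; move: A mA.
apply: (dynkin_induction (P := fun A => appr (\1_A)) G_gen G_setI).
- by rewrite indicT; exact: apprV.
- move=> U GU; have [f_ [Vf f1 fU]] := G_lim GU.
  apply: lim1 fU => //; first by move=> n; exact/apprV/Vf.
  by rewrite G_gen; exact: sub_sigma_algebra.
- move=> S mS AS.
  rewrite (_ : \1_(~` S) = (fun x => -1 * \1_S x + cst 1 x)).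
    by apply: apprD => //; exact: apprV.
  apply/funext => x; rewrite !indicE in_setC /cst.
  by case: (x \in S) => /=; rewrite ?mulr1 ?mulr0 ?add0r ?addNr.
move=> F mF tF AF.
have E n x : \sum_(i < n) (\1_(F i) x : R) = \1_(\big[setU/set0]_(i < n) F i) x.
  elim: n => [|n IH]; first by rewrite !big_ord0 indic0.
  rewrite !big_ord_recr/= IH !indicE in_setU.
  case: (boolP (x \in F n)) => xn /=; last by rewrite orbF addr0.
  rewrite orbT; case: (boolP (x \in _)) => [/set_mem|]; last by rewrite add0r.
  rewrite -bigcup_mkord => -[k /= kn Fkx]; have := set_mem xn => Fnx.
  have kn' : k = n by apply: tF => //; exists x.
  by rewrite kn' ltnn in kn.
apply: (lim1 (fun n x => \sum_(i < n) (\1_(F i) x : R))).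
- elim=> [|n [m IH]].
    under eq_fun do rewrite big_ord0.
    have -> : (fun=> 0) = (fun x => -1 * cst 1 x + cst 1 x) :> (T -> R).
      by apply/funext => x; rewrite /cst mulN1r addNr.
    by apply: apprD; exact: apprV.
  under eq_fun do rewrite big_ord_recr/= addrC -[X in X + _]mul1r.
  exact: apprD.
- exact: bigcup_measurable.
- by move=> n x; rewrite E.
move=> x; under eq_fun do rewrite E.
apply: cvg_near_cst; case: (pselect ((\bigcup_k F k) x)) => [[k _ Fkx]|nFx].
  exists k.+1 => // n /= kn; rewrite !indicE !mem_set//; first by exists k.
  by rewrite -bigcup_mkord; exists k.
apply: nearW => n; rewrite !indicE !memNset//.
by rewrite -bigcup_mkord => -[k _ Fkx]; apply: nFx; exists k.
Qed.

Import HBNNSimple.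

Let appr_nnsfun (f : {nnsfun T >-> R}) : appr f.
Proof.
rewrite (funext (fimfunEord f)); move: (finmap.enum_fset _) => s.
have H n : appr (fun x => \sum_(i < n) s`_i * \1_(f @^-1` [set s`_i]) x).
  elim: n => [|n IH].
    under eq_fun do rewrite big_ord0.
    have -> : (fun=> 0) = (fun x => -1 * cst 1 x + cst 1 x) :> (T -> R).
      by apply/funext => x; rewrite /cst mulN1r addNr.
    by apply: apprD; exact: apprV.
  under eq_fun do rewrite big_ord_recr/= addrC.
  apply: apprD => //; exact: appr_indic.
exact: H.
Qed.

Let appr_ge0 f : measurable_fun setT f -> (forall x, 0 <= f x) ->
  (sqdist mu D f (cst 0%R) < +oo)%E -> appr f.
Proof.
move=> mf f0 fi.
have mef : measurable_fun setT (EFin \o f) by exact/measurable_EFinP.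
have ef0 x : setT x -> (0 <= (EFin \o f) x)%E by rewrite /= lee_fin.
have ub n x : approx setT (EFin \o f) n x <= f x.
  by rewrite -lee_fin; exact: le_approx.
apply: (appr_lim (f_ := nnsfun_approx measurableT mef)) fi _ _ _ => //.
- by move=> n x _; rewrite ger0_norm// nnsfun_approxE.
- by move=> x _; rewrite ger0_norm.
move=> x _; under eq_fun do rewrite nnsfun_approxE.
by apply: (cvg_approx (f := EFin \o f)) => //; rewrite /= ltry.
Qed.

(** Dynkin's theorem reduces the density to the indicators of [G]: the sets
    with an approximable indicator form a Dynkin system since [V] is linear and
    the closure of [V] is stable under dominated limits.  Simple functions and
    their monotone limits follow. *)
Lemma sqdist_dense f : measurable_fun setT f ->
  (sqdist mu D f (cst 0%R) < +oo)%E ->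
  forall e : R, 0 < e -> exists2 h, V h & (sqdist mu D f h <= e%:E)%E.
Proof.
move=> mf fi.
suff : appr (fun x => -1 * f^\- x + f^\+ x).
  rewrite (_ : (fun x => _) = f); first by case.
  by rewrite -[RHS]funrposBneg; apply/funext => x; rewrite mulN1r addrC.
have mp : measurable_fun setT f^\+ by exact: measurable_funrpos.
have mn : measurable_fun setT f^\- by exact: measurable_funrneg.
have part (g : T -> R) : measurable_fun setT g ->
    (forall x, `|g x| <= `|f x|) -> (sqdist mu D g (cst 0%R) < +oo)%E.
  move=> mg gf; apply: le_lt_trans fi; apply: sqdist_ae_le => //.
  - exact: measurable_funTS.
  - exact: measurable_funTS.
  - by apply: aeW => x _; rewrite !subr0.
apply: apprD; apply: appr_ge0 => //; apply: part => // x.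
- rewrite ger0_norm ?funrneg_ge0// /funrneg ge_max normr_ge0 andbT.
  by rewrite -normrN ler_norm.
- by rewrite ger0_norm ?funrpos_ge0// /funrpos ge_max normr_ge0 andbT ler_norm.
Qed.

End density.

(** * Borel sets and Lipschitz functions of the plane *)

Section borel_plane.
Context {R : realType}.
Local Notation mplane := (measurableTypeR R * measurableTypeR R)%type.

(** Each open set is the union of the rational boxes that it contains. *)
Lemma open_measurable_plane (U : set (R * R)) : open U -> measurable (U : set mplane).
Proof.
move=> oU.
pose box (t : rat * rat * nat) : set mplane :=
  ball (ratr t.1.1 : R) (t.2.+1%:R^-1) `*` ball (ratr t.1.2 : R) (t.2.+1%:R^-1).
rewrite (_ : U = \bigcup_t (if `[< box t `<=` U >] then box t else set0)).
  apply: countable_bigcupT_measurable => // t; case: ifP => // _.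
  by apply: measurableX; rewrite ball_itv; exact: measurable_itv.
apply/seteqP; split=> [x Ux|x [t _]]; last by case: ifPn => // /asboolP tU; exact: tU.
have [e /= e0 xU] : nbhs_ball x U by apply/nbhs_ballP; exact: open_nbhs_nbhs.
have [n ne] : exists n, n.+1%:R^-1 < e / 2.
  exists (Num.truncn (e / 2)^-1); rewrite invf_plt ?posrE ?divr_gt0//.
  by rewrite truncnS_gt.
have n0 : 0 < n.+1%:R^-1 :> R by rewrite invr_gt0.
have near_rat (y r : R) : 0 < r -> exists q : rat, ball (ratr q : R) r y.
  move=> r0; have /rat_in_itvoo[q] : y - r < y + r by lra.
  rewrite in_itv/= => /andP[q1 q2]; exists q.
  by rewrite /ball/= ltr_norml; lra.
have [p px] := near_rat x.1 _ n0; have [q qx] := near_rat x.2 _ n0.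
exists (p, q, n) => //; case: ifPn; first by [].
move=> /asboolP []; move=> y [] /= py qy; apply: xU.
have tri a (b c : R) : ball a n.+1%:R^-1 b -> ball a n.+1%:R^-1 c -> ball b e c.
  move: (n.+1%:R^-1) ne => r re.
  by rewrite /ball/= !ltr_norml => /andP[? ?] /andP[? ?]; apply/andP; lra.
by split; [exact: tri px py|exact: tri qx qy].
Qed.

Lemma closed_measurable_plane (A : set (R * R)) : closed A -> measurable (A : set mplane).
Proof. by move=> /closed_openC/open_measurable_plane/measurableC; rewrite setCK. Qed.

(** Unlike the rectangles with measurable sides that generate the product
    sigma-algebra, open sets have indicators that are limits of continuous
    functions. *)
Lemma measurable_plane_gen_open :
  @measurable _ mplane = <<s (@open (R * R)%type : set (set mplane)) >>.
Proof.
apply/seteqP; split; last first.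
  apply: smallest_sub; first exact: sigma_algebra_measurable.
  by move=> U; exact: open_measurable_plane.
pose O : set (set mplane) := @open (R * R)%type.
have mfst : measurable_fun setT (fst : g_sigma_algebraType O -> measurableTypeR R).
  apply: (measurability _ (RGenOpens.measurableE R)).
  move=> _ [_ [a [b ->] <-]]; apply: sub_sigma_algebra; rewrite setTI.
  by apply: (@open_comp _ _ (fst : R * R -> R)) => [x _|]; [exact: cvg_fst|exact: interval_open].
have msnd : measurable_fun setT (snd : g_sigma_algebraType O -> measurableTypeR R).
  apply: (measurability _ (RGenOpens.measurableE R)).
  move=> _ [_ [a [b ->] <-]]; apply: sub_sigma_algebra; rewrite setTI.
  by apply: (@open_comp _ _ (snd : R * R -> R)) => [x _|]; [exact: cvg_snd|exact: interval_open].
rewrite measurable_prod_measurableType.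
apply: smallest_sub; first exact: smallest_sigma_algebra.
move=> _ [A mA [B mB <-]].
have -> : A `*` B = (fst @^-1` A) `&` (snd @^-1` B) by [].
apply: (@measurableI _ (g_sigma_algebraType O)).
- by rewrite -[X in measurable X]setTI; exact: mfst.
- by rewrite -[X in measurable X]setTI; exact: msnd.
Qed.

Lemma continuous_measurable_plane (f : R * R -> R) : continuous f ->
  measurable_fun setT (f : mplane -> R).
Proof.
move=> cf; apply: (measurability _ (RGenOpens.measurableE R)).
move=> _ [_ [a [b ->] <-]]; rewrite setTI; apply: open_measurable_plane.
by apply: open_comp => [x _|]; [exact: cf|exact: interval_open].
Qed.

End borel_plane.

Section lip.
Context {R : realType}.
Implicit Types (f g : R * R -> R) (A : set (R * R)).

(** A Lipschitz constant on the whole plane, for the sup norm. *)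
Definition lip f := exists2 L : R, 0 <= L &
  forall x y, `|f x - f y| <= L * `|x - y|.

Lemma lip_cst c : lip (cst c).
Proof. by exists 0 => // x y; rewrite subrr normr0 mul0r. Qed.

Lemma lip_lin a f g : lip f -> lip g -> lip (fun x => a * f x + g x).
Proof.
move=> [L L0 fL] [M M0 gM]; exists (`|a| * L + M).
  by rewrite addr_ge0// mulr_ge0.
move=> x y; rewrite (_ : _ - _ = a * (f x - f y) + (g x - g y)); last by ring.
rewrite (le_trans (ler_normD _ _))// mulrDl lerD// normrM -mulrA.
by rewrite ler_wpM2l.
Qed.

Lemma lip_min f g : lip f -> lip g -> lip (fun x => Num.min (f x) (g x)).
Proof.
move=> [L L0 fL] [M M0 gM]; exists (L + M); first exact: addr_ge0.
move=> x y; rewrite mulrDl; have := fL x y; have := gM x y.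
move: (L * _) (M * _) => u v; rewrite !ler_norml.
by rewrite /Num.min; case: ifPn; case: ifPn; rewrite -?leNgt; lra.
Qed.

Lemma lip_max f g : lip f -> lip g -> lip (fun x => Num.max (f x) (g x)).
Proof.
move=> [L L0 fL] [M M0 gM]; exists (L + M); first exact: addr_ge0.
move=> x y; rewrite mulrDl; have := fL x y; have := gM x y.
move: (L * _) (M * _) => u v; rewrite !ler_norml.
by rewrite /Num.max; case: ifPn; case: ifPn; rewrite -?leNgt; lra.
Qed.

Lemma lip_continuous f : lip f -> continuous f.
Proof.
move=> [L L0 fL] x; apply/cvgrPdist_le => e e0; near=> y.
apply: (le_trans (fL _ _)).
have : `|x - y| <= e / (L + 1).
  near: y; apply: cvgr_dist_le => //.
  by rewrite divr_gt0// ltr_wpDl.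
move=> h; apply: (@le_trans _ _ (L * (e / (L + 1)))); first by rewrite ler_wpM2l.
rewrite mulrCA ger_pMr// ler_pdivrMr ?ltr_wpDl//; lra.
Unshelve. all: by end_near. Qed.

(** The distance to [A], capped at 1 so that the infimum is over a nonempty set
    even when [A] is empty. *)
Definition cdist A x : R := inf ([set 1] `|` [set `|x - y| | y in A]).

Let lbound0 A x : lbound ([set 1] `|` [set `|x - y| | y in A]) 0.
Proof. by move=> _ [->|[y _ <-]]. Qed.

Let nonempty1 A x : ([set 1] `|` [set `|x - y| | y in A]) !=set0.
Proof. by exists 1; left. Qed.

Lemma cdist_ge0 A x : 0 <= cdist A x.
Proof. by apply: lb_le_inf => //; exact: lbound0. Qed.

Lemma cdist_le1 A x : cdist A x <= 1.
Proof. by apply: ge_inf; [exists 0; exact: lbound0|left]. Qed.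

Lemma cdist_le A x y : A y -> cdist A x <= `|x - y|.
Proof. by move=> Ay; apply: ge_inf; [exists 0; exact: lbound0|right; exists y]. Qed.

Lemma cdist_lb A x r : r <= 1 -> (forall y, A y -> r <= `|x - y|) -> r <= cdist A x.
Proof. by move=> r1 rA; apply: lb_le_inf => // _ [->//|[y Ay <-]]; exact: rA. Qed.

Lemma cdist_eq0 A x : A x -> cdist A x = 0.
Proof.
move=> Ax; apply/eqP; rewrite eq_le cdist_ge0 andbT.
by rewrite (le_trans (cdist_le _ Ax))// subrr normr0.
Qed.

Lemma cdist_gt0 A x : ~ closure A x -> 0 < cdist A x.
Proof.
move=> nAx; have : nbhs x (~` A).
  by apply: contrapT => h; apply: nAx => B xB; apply: contrapT => AB; apply: h;
    apply: filterS xB => z Bz Az; apply: AB; exists z.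
move=> /nbhs_ballP[r /= r0 xr]; apply: (@lt_le_trans _ _ (Num.min 1 r)).
  by rewrite lt_min ltr01.
apply: cdist_lb => [|y Ay]; first by rewrite ge_min lexx.
rewrite ge_min; apply/orP; right; rewrite leNgt; apply/negP => xy.
by apply: (xr y) => //; rewrite -ball_normE.
Qed.

Lemma lip_cdist A : lip (cdist A).
Proof.
have H x y : cdist A x - `|x - y| <= cdist A y.
  apply: cdist_lb => [|z Az]; first by have := cdist_le1 A x; have := normr_ge0 (x - y); lra.
  by have := cdist_le x Az; have := ler_distD y x z; lra.
exists 1 => // x y; rewrite mul1r ler_norml.
by have := H x y; have := H y x; rewrite (distrC y x); lra.
Qed.

Local Notation mplane := (measurableTypeR R * measurableTypeR R)%type.

Lemma lip_measurable f : lip f -> measurable_fun setT (f : mplane -> R).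
Proof. by move=> /lip_continuous; exact: continuous_measurable_plane. Qed.

(** The functions [min 1 (n d)], with [d] the distance to the complement of an
    open set, increase to the indicator of that set. *)
Lemma lip_dense_L2 (mu : {measure set mplane -> \bar R}) (D : set mplane)
    (f : mplane -> R) (e : R) :
  measurable D -> (mu D < +oo)%E -> measurable_fun setT f ->
  (sqdist mu D f (cst 0%R) < +oo)%E -> 0 < e ->
  exists2 h : R * R -> R, lip h & (sqdist mu D f h <= e%:E)%E.
Proof.
move=> mD muD mf fi.
apply: (@sqdist_dense _ mplane R mu D mD muD lip (@open (R * R)%type)) => //.
- exact: lip_measurable.
- by move=> a g h; exact: lip_lin.
- exact: lip_cst.
- exact: measurable_plane_gen_open.
- by move=> U V; exact: openI.
move=> U oU; exists (fun n (x : R * R) => Num.min 1 (n%:R * cdist (~` U) x)); split.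
- move=> n; apply: lip_min; first exact: lip_cst.
  under eq_fun do rewrite -[_ * _]addr0.
  by apply: (lip_lin _ (lip_cdist _)); exact: lip_cst.
- move=> n x; rewrite ger0_norm; first by rewrite ge_min lexx.
  by rewrite le_min ler01 mulr_ge0// cdist_ge0.
move=> x; apply: cvg_near_cst; rewrite indicE.
have [/set_mem Ux|/negP nUx] := boolP (x \in U); last first.
  apply: nearW => n; rewrite cdist_eq0 ?mulr0; last by move/mem_set; exact: nUx.
  by rewrite min_r.
have d0 : 0 < cdist (~` U) x.
  by apply: cdist_gt0; have /closure_id <- := open_closedC oU; exact.
near=> n; rewrite min_l// -ler_pdivrMr// div1r.
by near: n; exact: nbhs_infty_ger.
Unshelve. all: by end_near. Qed.
End lip.

(** * Bernstein polynomials *)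

Section bernstein.
Context {R : realType}.
Implicit Types (F G : nat -> R) (x y u : R).

(** The Bernstein polynomial of the values [F 0, ..., F n] at [x], that is, the
    expectation of [F] under the binomial law, by conditioning on the first
    trial.  The recursion replaces binomial coefficients in all proofs. *)
Fixpoint bern n F x : R :=
  if n is m.+1 then x * bern m (F \o succn) x + (1 - x) * bern m F x else F 0%N.

Lemma bern_cst n c x : bern n (fun=> c) x = c.
Proof. by elim: n => //= n; rewrite /comp => ->; ring. Qed.

Lemma bern_lin n a F G x :
  bern n (fun i => a * F i + G i) x = a * bern n F x + bern n G x.
Proof. by elim: n F G => //= n IH F G; rewrite /comp/= !IH; ring. Qed.

Lemma le_bern n F G x : 0 <= x <= 1 -> (forall i, F i <= G i) ->
  bern n F x <= bern n G x.
Proof.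
move=> /andP[x0 x1]; elim: n F G => //= n IH F G FG.
by apply: lerD; apply: ler_wpM2l; rewrite ?subr_ge0//; apply: IH => i; exact: FG.
Qed.

(** Jensen's inequality for the absolute value. *)
Lemma bern_dist n F x c : 0 <= x <= 1 ->
  `|bern n F x - c| <= bern n (fun i => `|F i - c|) x.
Proof.
move=> x01; rewrite ler_norml.
have -> : bern n F x - c = bern n (fun i => F i - c) x.
  rewrite (_ : (fun i => F i - c) = fun i => 1 * F i + (- c)).
    by rewrite bern_lin bern_cst mul1r.
  by apply/funext => i; rewrite mul1r.
apply/andP; split; last by apply: le_bern => // i; exact: ler_norm.
rewrite [leLHS](_ : _ = bern n (fun i => -1 * `|F i - c| + 0) x).
  by apply: le_bern => // i; rewrite addr0 mulN1r lerNl -normrN ler_norm.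
by rewrite bern_lin bern_cst addr0 mulN1r.
Qed.

(** Second moment of the binomial law about an arbitrary point [a]: the
    induction shifts the centre, so that a statement for the mean alone would
    not go through. *)
Lemma bern_variance n a x :
  bern n (fun i => (i%:R - a) ^+ 2) x = (n%:R * x - a) ^+ 2 + n%:R * (x * (1 - x)).
Proof.
elim: n a => [|n IH] a /=; first by ring.
rewrite (_ : _ \o succn = fun i => (i%:R - (a - 1)) ^+ 2); last first.
  by apply/funext => i /=; rewrite -natr1; ring.
by rewrite !IH -natr1; ring.
Qed.

(** The mean deviation of a frequency is at most its standard deviation, hence
    of order [n ^ (- 1/2)] uniformly in [u]. *)
Lemma bern_absdev e : 0 < e -> exists2 n, (0 < n)%N &
  forall u, 0 <= u <= 1 -> bern n (fun i => `|i%:R / n%:R - u|) u <= e.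
Proof.
move=> e0; exists (Num.truncn (e ^+ 2)^-1).+1 => // u /andP[u0 u1].
set n := _.+1; have n0 : 0 < n%:R :> R by rewrite ltr0n.
have ne : 1 <= n%:R * e ^+ 2.
  by rewrite -ler_pdivrMr ?exprn_gt0// div1r ltW// truncnS_gt.
set m : R := n%:R in n0 ne *.
apply: (@le_trans _ _ (bern n
    (fun i => (e * m ^+ 2)^-1 * (i%:R - m * u) ^+ 2 + e / 2) u)); last first.
  rewrite bern_lin bern_cst bern_variance -/m subrr expr0n add0r.
  have h : u * (1 - u) <= 4^-1 by have := sqr_ge0 (2 * u - 1); lra.
  suff : (e * m ^+ 2)^-1 * (m * (u * (1 - u))) <= e / 4 by lra.
  rewrite mulrC ler_pdivrMr ?mulr_gt0 ?exprn_gt0//.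
  rewrite (_ : e / 4 * _ = (m * e ^+ 2) * m / 4); last by ring.
  apply: (@le_trans _ _ (m * 4^-1)); first by rewrite ler_pM2l.
  by rewrite ler_pM2r// ler_peMl// ltW.
apply: le_bern => [|i]; first by rewrite u0.
(* [`|t| <= t^2 / e + e / 4], since [(`|t| - e / 2)^2] is nonnegative *)
set t := _ - u; have -> : (e * m ^+ 2)^-1 * (i%:R - m * u) ^+ 2 = t ^+ 2 / e.
  by rewrite /t; field; rewrite !gt_eqF.
have : 0 <= (`|t| - e / 2) ^+ 2 / e by rewrite divr_ge0 ?sqr_ge0// ltW.
rewrite sqrrB real_normK ?num_real// (_ : _ / e = t ^+ 2 / e - `|t| + e / 4); first by lra.
by field; rewrite gt_eqF.
Qed.

End bernstein.

(** * Polynomial functions of two variables *)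

Section polyfun.
Context {R : realType}.
Implicit Types (f g q : R * R -> R).

(** Polynomial functions of two variables, as the closure of the coordinates
    and constants under the ring operations: every property below is an
    induction on this closure. *)
Inductive polyfun : (R * R -> R) -> Prop :=
| polyfun_cst c : polyfun (fun=> c)
| polyfun_fst : polyfun fst
| polyfun_snd : polyfun snd
| polyfun_add f g : polyfun f -> polyfun g -> polyfun (fun x => f x + g x)
| polyfun_mul f g : polyfun f -> polyfun g -> polyfun (fun x => f x * g x).

Lemma polyfun_lin (a : R) f g : polyfun f -> polyfun g ->
  polyfun (fun x => a * f x + g x).
Proof.
by move=> pf pg; apply: polyfun_add => //; apply: polyfun_mul => //; exact: polyfun_cst.
Qed.

Lemma polyfun_bern n (F : nat -> R * R -> R) q : (forall i, polyfun (F i)) ->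
  polyfun q -> polyfun (fun z => bern n (F ^~ z) (q z)).
Proof.
move=> pF pq; elim: n F pF => [|n IH] F pF /=; first exact: pF.
apply: polyfun_add; apply: polyfun_mul => //.
- by apply: (IH (fun i => F i.+1)) => i; exact: pF.
- rewrite (_ : (fun x => 1 - q x) = fun x => -1 * q x + 1).
    by apply: polyfun_lin => //; exact: polyfun_cst.
  by apply/funext => x; rewrite mulN1r addrC.
- exact: IH.
Qed.

Lemma polyfun_continuous f : polyfun f -> continuous f.
Proof.
elim=> {f} [c|||f g _ cf _ cg|f g _ cf _ cg] x.
- exact: cvg_cst.
- exact: cvg_fst.
- exact: cvg_snd.
- by apply: cvgD; [exact: cf|exact: cg].
- by apply: cvgM; [exact: cf|exact: cg].
Qed.

Lemma is_derive_fst (x v : R * R) : is_derive x v fst v.1.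
Proof.
have H : (fun h : R => h^-1 *: ((fst \o shift x) (h *: v) - x.1)) @ 0^' --> v.1.
  apply: cvg_near_cst; near=> h => /=.
  by rewrite addrK /GRing.scale/= mulrA mulVf ?mul1r//; near: h; exact: nbhs_dnbhs_neq.
split; first by apply/cvg_ex; exists v.1.
exact/cvg_lim.
Unshelve. all: by end_near. Qed.

Lemma is_derive_snd (x v : R * R) : is_derive x v snd v.2.
Proof.
have H : (fun h : R => h^-1 *: ((snd \o shift x) (h *: v) - x.2)) @ 0^' --> v.2.
  apply: cvg_near_cst; near=> h => /=.
  by rewrite addrK /GRing.scale/= mulrA mulVf ?mul1r//; near: h; exact: nbhs_dnbhs_neq.
split; first by apply/cvg_ex; exists v.2.
exact/cvg_lim.
Unshelve. all: by end_near. Qed.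

Lemma polyfun_derive (v : R * R) f : polyfun f ->
  exists2 f', polyfun f' & forall x, is_derive x v f (f' x).
Proof.
elim=> {f} [c|||f g pf [f' pf' df] pg [g' pg' dg]|f g pf [f' pf' df] pg [g' pg' dg]].
- exists (fun=> 0); first exact: polyfun_cst.
  by move=> x; exact: is_derive_cst.
- by exists (fun=> v.1); [exact: polyfun_cst|move=> x; exact: is_derive_fst].
- by exists (fun=> v.2); [exact: polyfun_cst|move=> x; exact: is_derive_snd].
- exists (fun x => f' x + g' x); first exact: polyfun_add.
  by move=> x; exact: is_deriveD.
- exists (fun x => f x * g' x + g x * f' x).
    by apply: polyfun_add; exact: polyfun_mul.
  by move=> x; exact: is_deriveM.
Qed.

Lemma polyfun_Cinfty D f : polyfun f -> Cinfty_closure D f.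
Proof.
move=> pf k; elim: k f pf => [|k IH] f pf /=.
  by split => //; apply: continuous_subspaceT; exact: polyfun_continuous.
split; first by apply: continuous_subspaceT; exact: polyfun_continuous.
have [f1 pf1 df1] := polyfun_derive (1, 0) pf.
have [f2 pf2 df2] := polyfun_derive (0, 1) pf.
by exists f1, f2; split; [move=> x _; exact: df1|move=> x _; exact: df2|exact: IH|exact: IH].
Qed.

Lemma polyfun_lip_bounded M f : polyfun f ->
  exists2 L : R, 0 <= L & forall x y, `|x| <= M -> `|y| <= M ->
    `|f x| <= L /\ `|f x - f y| <= L * `|x - y|.
Proof.
elim=> {f} [c|||f g _ [L L0 fL] _ [K K0 gK]|f g _ [L L0 fL] _ [K K0 gK]].
- by exists `|c| => // x y _ _; split; rewrite // subrr normr0 mulr_ge0.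
- exists (Num.max 1 M); first by rewrite le_max ler01.
  move=> x y xM yM; split.
    by rewrite le_max; apply/orP; right; apply: le_trans xM; rewrite /Num.norm/= le_max lexx.
  apply: (@le_trans _ _ (1 * `|x - y|)); first by rewrite mul1r {2}/Num.norm/= le_max lexx.
  by rewrite ler_wpM2r// le_max lexx.
- exists (Num.max 1 M); first by rewrite le_max ler01.
  move=> x y xM yM; split.
    by rewrite le_max; apply/orP; right; apply: le_trans xM; rewrite /Num.norm/= le_max lexx orbT.
  apply: (@le_trans _ _ (1 * `|x - y|)); first by rewrite mul1r {2}/Num.norm/= le_max lexx orbT.
  by rewrite ler_wpM2r// le_max lexx.
- exists (L + K); first exact: addr_ge0.
  move=> x y xM yM; have [f1 f2] := fL _ _ xM yM; have [g1 g2] := gK _ _ xM yM.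
  split; first by apply: (le_trans (ler_normD _ _)); exact: lerD.
  rewrite (_ : _ - _ = (f x - f y) + (g x - g y)); last by ring.
  by apply: (le_trans (ler_normD _ _)); rewrite mulrDl lerD.
- exists (L * K + L * K); first by rewrite addr_ge0// mulr_ge0.
  move=> x y xM yM; have [f1 f2] := fL _ _ xM yM; have [g1 g2] := gK _ _ xM yM.
  have [f3 _] := fL _ _ yM xM.
  split.
    by rewrite normrM (@le_trans _ _ (L * K))// ?ler_pM// lerDl mulr_ge0.
  rewrite (_ : _ - _ = (f x - f y) * g x + f y * (g x - g y)); last by ring.
  apply: (le_trans (ler_normD _ _)); rewrite !normrM mulrDl lerD//.
    by rewrite mulrAC ler_pM.
  by rewrite -mulrA ler_pM.
Qed.

(** Weierstrass' theorem on a square: the Bernstein polynomial in each variable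
    averages [f] over nodes whose mean distance to the point is small. *)
Lemma lip_polyfun_approx M f (e : R) : lip f -> 0 < M -> 0 < e ->
  exists2 p, polyfun p & forall x, `|x| <= M -> `|p x - f x| <= e.
Proof.
move=> [L L0 fL] M0 e0.
have K0 : 0 < 4 * M * (L + 1) by rewrite !mulr_gt0// ltr_wpDl.
have [n n0 dev] := bern_absdev (divr_gt0 e0 K0).
have nR : 0 < n%:R :> R by rewrite ltr0n.
pose node (i : nat) : R := 2 * M * (i%:R / n%:R) - M.
(* the affine bijection from [-M, M] to [0, 1] *)
pose param (t : R) := (2 * M)^-1 * t + 2^-1.
have M2 : 2 * M != 0 by rewrite gt_eqF// mulr_gt0.
have paramK t : 2 * M * param t - M = t by rewrite /param; field; rewrite gt_eqF.
have node_dist i t : `|node i - t| = 2 * M * `|i%:R / n%:R - param t|.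
  rewrite -{1}(paramK t) /node (_ : _ - _ = 2 * M * (i%:R / n%:R - param t)).
    by rewrite normrM gtr0_norm// mulr_gt0.
  by ring.
have param01 t : `|t| <= M -> 0 <= param t <= 1.
  rewrite ler_norml => /andP[t1 t2]; rewrite -(paramK t) in t1 t2.
  have : 0 <= 2 * M * param t by lra.
  have : 2 * M * param t <= 2 * M * 1 by lra.
  by rewrite pmulr_rge0 ?mulr_gt0// ler_pM2l ?mulr_gt0// => -> ->.
have pparam q : polyfun q -> polyfun (fun z => param (q z)).
  by move=> pq; apply: polyfun_lin => //; exact: polyfun_cst.
exists (fun z => bern n (fun i => bern n (fun j => f (node i, node j)) (param z.2))
                   (param z.1)).
  apply: (@polyfun_bern n (fun i z => bern n (fun j => f (node i, node j)) (param z.2))).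
    move=> i; apply: (@polyfun_bern n (fun j z => f (node i, node j))).
      by move=> j; exact: polyfun_cst.
    exact/pparam/polyfun_snd.
  exact/pparam/polyfun_fst.
move=> [s t] stM.
have sM : `|s| <= M by apply: le_trans stM; rewrite {2}/Num.norm/= le_max lexx.
have tM : `|t| <= M by apply: le_trans stM; rewrite {2}/Num.norm/= le_max lexx orbT.
have {}sM := param01 _ sM; have {}tM := param01 _ tM => /=.
apply: (le_trans (bern_dist _ _ _ sM)).
pose C := 2 * M * L.
have C0 : 0 <= C by rewrite !mulr_ge0// ltW.
have Cdev : C * (e / (4 * M * (L + 1))) <= e / 2.
  rewrite mulrA ler_pdivrMr// /C.
  have := mulr_gt0 M0 e0; have := mulr_ge0 (ltW (mulr_gt0 M0 e0)) L0; nra.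
apply: (@le_trans _ _ (bern n (fun i => C * `|i%:R / n%:R - param s| + e / 2) (param s))).
  apply: le_bern => // i; apply: (le_trans (bern_dist _ _ _ tM)).
  apply: (@le_trans _ _ (bern n (fun j => C * `|j%:R / n%:R - param t|
      + C * `|i%:R / n%:R - param s|) (param t))).
    apply: le_bern => // j; apply: (le_trans (fL _ _)).
    rewrite /C -!(mulrA _ L) !(mulrCA _ L) -mulrDr ler_wpM2l//.
    rewrite -!node_dist {1}/Num.norm/= ge_max.
    by rewrite lerDr normr_ge0 lerDl normr_ge0.
  rewrite bern_lin bern_cst addrC lerD2l.
  apply: le_trans Cdev; rewrite ler_wpM2l//; exact: dev.
rewrite bern_lin bern_cst [leRHS]splitr lerD2r.
by apply: le_trans Cdev; rewrite ler_wpM2l//; exact: dev.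
Qed.
End polyfun.

(** * Removing critical zeros *)

Section perturbation.
Context {R : realType}.

Lemma enorm_ge0 (x : R * R) : 0 <= enorm x.
Proof. exact: sqrtr_ge0. Qed.

Lemma enorm_eq0 (x : R * R) : enorm x = 0 -> x = 0.
Proof.
move=> /eqP; rewrite sqrtr_eq0 => h.
have /andP[] : (x.1 ^+ 2 == 0) && (x.2 ^+ 2 == 0).
  by rewrite -paddr_eq0 ?sqr_ge0// eq_le h addr_ge0// sqr_ge0.
by rewrite !sqrf_eq0; case: x {h} => a b /= /eqP -> /eqP ->.
Qed.

(** A Lipschitz image of a square in three dimensions misses a point of every
    cube.  Cut the square into [N^2] cells and the cube into a grid of [m^3]
    points, with [N = m q].  Once [q] exceeds a constant, the image of a cell is
    smaller than the spacing of the grid, so that each cell reaches at most one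
    grid point; and [m^3 > N^2] as soon as [m > q^2]. *)
Lemma lip_image_misses_small_point (F : 'I_3 -> R * R -> R) (K M eta : R) :
  0 < M -> 0 < eta -> 0 <= K ->
  (forall k x y, `|x| <= M -> `|y| <= M -> `|F k x - F k y| <= K * `|x - y|) ->
  exists2 a : 'I_3 -> R, (forall k, 0 <= a k <= eta) &
    forall x, `|x| < M -> exists k, F k x <> a k.
Proof.
move=> M0 eta0 K0 FK; apply: contrapT => H.
pose q := (Num.truncn (2 * M * K / eta)).+1.
pose m := (q * q).+1; pose N := (m * q)%N.
have qK : 2 * M * K < eta * q%:R.
  by rewrite mulrC -[X in X < _]mulrC [ltRHS]mulrC -ltr_pdivrMr//; exact: truncnS_gt.
have q0 : 0 < q%:R :> R by rewrite ltr0n.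
have m0 : 0 < m%:R :> R by rewrite ltr0n.
have N0 : 0 < N%:R :> R by rewrite ltr0n muln_gt0.
have cell (s : R) : - M < s -> s < M ->
    exists c : 'I_N, (c%:R : R) <= N%:R * ((s + M) / (2 * M)) < c%:R + 1.
  move=> s1 s2; set u := _ * (_ / _).
  have u0 : 0 <= u by rewrite mulr_ge0// divr_ge0//; lra.
  have uN : (Num.truncn u < N)%N.
    rewrite -(ltr_nat R); apply: (@le_lt_trans _ _ u); first by rewrite truncn_le.
    by rewrite /u gtr_pMr// ltr_pdivrMr; lra.
  exists (Ordinal uN) => /=; by rewrite truncn_le u0/= natr1 truncnS_gt.
have cells (t : {ffun 'I_3 -> 'I_m}) : exists c : 'I_N * 'I_N, exists x : R * R,
    [/\ `|x| < M, forall k, F k x = eta * (t k)%:R / m%:R,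
        (c.1%:R : R) <= N%:R * ((x.1 + M) / (2 * M)) < c.1%:R + 1
      & (c.2%:R : R) <= N%:R * ((x.2 + M) / (2 * M)) < c.2%:R + 1].
  have [x xM Fx] : exists2 x : R * R, `|x| < M & forall k, F k x = eta * (t k)%:R / m%:R.
    apply: contrapT => nx; apply: H; exists (fun k => eta * (t k)%:R / m%:R).
      move=> k; rewrite divr_ge0 ?mulr_ge0 ?(ltW eta0)//= ler_pdivrMr// ler_pM2l//.
      by rewrite ler_nat ltnW.
    move=> x xM; apply: contrapT => nk; apply: nx; exists x => // k.
    by apply: contrapT => Fk; apply: nk; exists k.
  have /andP[] : (`|x.1| < M) && (`|x.2| < M) by rewrite -gt_max.
  rewrite !ltr_norml => /andP[x1 x1'] /andP[x2 x2'].
  have [c1 h1] := cell _ x1 x1'; have [c2 h2] := cell _ x2 x2'.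
  by exists (c1, c2), x.
have [f fP] := choice cells.
have f_inj : injective f.
  move=> t t' ftt'; apply/ffunP => k; apply/val_inj/eqP; rewrite /=.
  have [x [xM Fx x1 x2]] := fP t; have [y [yM Fy y1 y2]] := fP t'.
  rewrite -ftt' in y1 y2.
  have close (c s s' : R) : c <= N%:R * ((s + M) / (2 * M)) < c + 1 ->
      c <= N%:R * ((s' + M) / (2 * M)) < c + 1 -> `|s - s'| <= 2 * M / N%:R.
    move=> /andP[h1 h2] /andP[h3 h4].
    have -> : s - s' = (N%:R * ((s + M) / (2 * M)) - N%:R * ((s' + M) / (2 * M)))
        * (2 * M / N%:R).
      by field; rewrite !gt_eqF.
    rewrite normrM [X in _ * X]gtr0_norm ?divr_gt0 ?mulr_gt0//.
    apply: ler_piMl; first by rewrite ltW// divr_gt0// mulr_gt0.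
    by rewrite ler_norml; apply/andP; lra.
  have xy : `|x - y| <= 2 * M / N%:R.
    by rewrite {1}/Num.norm/= ge_max (close _ _ _ x1 y1) (close _ _ _ x2 y2).
  have := FK k x y (ltW xM) (ltW yM); rewrite Fx Fy => h.
  apply: contrapT => /negP tk.
  have t1 : 1 <= `|(t k)%:R - (t' k)%:R : R|.
    move: tk; rewrite neq_ltn => /orP[] lt.
      by rewrite distrC (le_trans _ (ler_norm _))// lerBrDr nat1r ler_nat.
    by rewrite (le_trans _ (ler_norm _))// lerBrDr nat1r ler_nat.
  have : eta / m%:R <= K * (2 * M / N%:R).
    apply: le_trans (ler_wpM2l K0 xy); apply: le_trans h.
    rewrite (_ : _ - _ = ((t k)%:R - (t' k)%:R) * (eta / m%:R)); last by ring.
    rewrite normrM [`|eta / _|]gtr0_norm ?divr_gt0//.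
    by rewrite ler_peMl// ltW// divr_gt0.
  rewrite ler_pdivrMr// (_ : K * _ * _ = 2 * M * K / q%:R); last first.
    by rewrite /N natrM; field; rewrite !gt_eqF.
  by rewrite ler_pdivlMr// leNgt qK.
have := leq_card f f_inj.
rewrite card_ffun card_prod !card_ord /N.
apply/negP; rewrite -ltnNge (_ : m * q * (m * q) = m ^ 2 * (q * q))%N.
  by rewrite (expnSr m 2) ltn_pmul2l// expn_gt0.
by rewrite mulnACA mulnn.
Qed.

(** If [q = p - b1 x - b2 y - b3] and its gradient vanish at a point, then
    [d1 p = b1], [d2 p = b2], and hence [p - x d1 p - y d2 p = b3] there. *)
Lemma polyfun_nondegenerate_approx (p : R * R -> R) (M e : R) :
  polyfun p -> 0 < M -> 0 < e ->
  exists2 q, polyfun q & (forall x, `|x| <= M -> `|q x - p x| <= e) /\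
    (forall x, `|x| < M -> 0 < enorm (grad q x) + `|q x|).
Proof.
move=> pp M0 e0.
have [p1 pp1 dp1] := polyfun_derive (1, 0) pp.
have [p2 pp2 dp2] := polyfun_derive (0, 1) pp.
pose p3 x := p x + (-1) * (x.1 * p1 x + x.2 * p2 x).
have pp3 : polyfun p3.
  apply: polyfun_add => //; apply: polyfun_mul; first exact: polyfun_cst.
  by apply: polyfun_add; apply: polyfun_mul => //; [exact: polyfun_fst|exact: polyfun_snd].
have [K1 K10 L1] := polyfun_lip_bounded M pp1.
have [K2 K20 L2] := polyfun_lip_bounded M pp2.
have [K3 K30 L3] := polyfun_lip_bounded M pp3.
pose F (k : 'I_3) := [:: p1; p2; p3]`_k.
pose eta := e / (1 + 2 * M).
have eta0 : 0 < eta by rewrite divr_gt0// ltr_pwDl// mulr_ge0// ltW.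
have K0 : 0 <= K1 + K2 + K3 by rewrite !addr_ge0.
have [|a a0 aF] := @lip_image_misses_small_point F (K1 + K2 + K3) M eta M0 eta0 K0.
  move=> [[|[|[|//]]] ?] x y xM yM; rewrite /F/=.
  - by apply: le_trans (L1 _ _ xM yM).2 _; rewrite ler_wpM2r//; lra.
  - by apply: le_trans (L2 _ _ xM yM).2 _; rewrite ler_wpM2r//; lra.
  - by apply: le_trans (L3 _ _ xM yM).2 _; rewrite ler_wpM2r//; lra.
pose b1 := a (inord 0); pose b2 := a (inord 1); pose b3 := a (inord 2).
pose q x := p x + ((- b1) * x.1 + ((- b2) * x.2 + (- b3))).
exists q.
  apply: polyfun_add => //; apply: polyfun_lin; first exact: polyfun_fst.
  by apply: polyfun_lin; [exact: polyfun_snd|exact: polyfun_cst].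
have in_box k : 0 <= a (inord k) <= eta by exact: a0.
split=> x xM.
  have /andP[x1 x2] : (`|x.1| <= M) && (`|x.2| <= M) by rewrite -ge_max.
  rewrite /q addrC addKr.
  apply: (@le_trans _ _ (eta * `|x.1| + (eta * `|x.2| + eta))).
    have abound k y : `|- a (inord k) * y| <= eta * `|y|.
      by rewrite normrM normrN ler_wpM2r// ger0_norm; case/andP: (in_box k).
    apply: (le_trans (ler_normD _ _)); apply: lerD; first exact: abound.
    apply: (le_trans (ler_normD _ _)); apply: lerD; first exact: abound.
    by rewrite normrN ger0_norm; case/andP: (in_box 2%N).
  have -> : e = eta * (M + (M + 1)).
    by rewrite /eta; field; rewrite gt_eqF// ltr_pwDl// mulr_ge0// ltW.
  by rewrite !mulrDr mulr1 lerD ?ler_pM2l// lerD// ler_pM2l.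
have [k] := aF _ xM.
rewrite lt0r addr_ge0 ?enorm_ge0// andbT => Fk; apply/eqP => q0; apply: Fk.
move/eqP: q0; rewrite paddr_eq0 ?enorm_ge0// => /andP[/eqP/enorm_eq0 gq].
rewrite normr_eq0 => /eqP qx.
have dlin (v : R * R) : is_derive x v (fun x => - b1 * x.1 + (- b2 * x.2 + - b3))
    (- b1 * v.1 + (- b2 * v.2)).
  have -> : - b1 * v.1 + - b2 * v.2 = - b1 *: v.1 + (- b2 *: v.2 + 0) by rewrite addr0.
  apply: is_deriveD; first exact: is_deriveZ (is_derive_fst x v).
  apply: is_deriveD; first exact: is_deriveZ (is_derive_snd x v).
have q1 := @derive_val _ _ _ _ _ _ _ (is_deriveD (dp1 x) (dlin (1, 0))).
have q2 := @derive_val _ _ _ _ _ _ _ (is_deriveD (dp2 x) (dlin (0, 1))).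
move: gq => [] /=; rewrite q1 q2 /= !mulr1 !mulr0 addr0 add0r => h1 h2.
move: qx; rewrite /q => h3.
have {}h1 : p1 x = b1 by lra.
have {}h2 : p2 x = b2 by lra.
have {}h3 : p3 x = b3 by rewrite /p3 h1 h2; lra.
have kE : k = inord k by rewrite inord_val.
rewrite kE /F; case: k kE => [[|[|[|//]]] ?] _ /=; rewrite inordK//=.
Qed.

End perturbation.

(** * Square integrable functions and cutoffs *)

Section plane_L2.
Context {R : realType}.
Local Notation mplane := (measurableTypeR R * measurableTypeR R)%type.
Implicit Types (D E A : set (R * R)) (f g : R * R -> R).
Local Notation mu := (@plane_measure R).

Lemma bounded_plane_measure D : bounded_set D -> measurable (D : set mplane) ->
  (mu (D : set mplane) < +oo)%E.
Proof.
move=> [M [_ Mb]] mD; pose I : set R := `[- (M + 1), M + 1]%classic.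
have mI : measurable (I : set (measurableTypeR R)) by exact: measurable_itv.
apply: (@le_lt_trans _ _ (mu ((I `*` I) : set mplane))).
  apply: le_measure; rewrite ?inE//; first exact: measurableX.
  move=> x Dx; have : `|x| <= M + 1 by apply: Mb; rewrite ?ltrDl.
  by rewrite {1}/Num.norm/= ge_max !ler_norml => /andP[h1 h2]; split; rewrite /I/= in_itv.
have -> : mu (I `*` I : set mplane)
    = (@lebesgue_measure R I * @lebesgue_measure R I)%E.
  exact: product_measure1E.
by rewrite /I lebesgue_measure_itv/=; case: ifP => _; rewrite ?mul0e// -EFinM ltry.
Qed.

Lemma Lnorm2_restrict D f : measurable (D : set mplane) ->
  Lnorm mu 2%:E (EFin \o (f \_ D : mplane -> R))
  = ((sqdist mu (D : set mplane) f (cst 0%R)) `^ 2^-1)%E.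
Proof.
move=> mD; rewrite unlock; congr (_ `^ _)%E.
rewrite /sqdist [RHS]integral_mkcond; apply: eq_integral => x _.
rewrite /= !patchE; case: ifP => _.
  by rewrite powR_mulrn// real_normK ?num_real// subr0.
by rewrite normr0 powR0.
Qed.

Lemma L2P D f : measurable (D : set mplane) ->
  L2 D f <-> measurable_fun setT (f \_ D : mplane -> R) /\
    (sqdist mu (D : set mplane) f (cst 0%R) < +oo)%E.
Proof.
move=> mD; split.
  move=> /andP[/set_mem mf /set_mem fi]; split => //; move: fi.
  rewrite /= /finite_norm Lnorm2_restrict//.
  by apply: lty_poweRy; rewrite invr_eq0.
move=> [mf fi]; apply/andP; split; apply/mem_set => //=.
by rewrite /finite_norm Lnorm2_restrict//; exact: poweR_lty.
Qed.

(** The rate [(m + 1)^-2] makes the L^2 norms at most [(m + 1)^-1]. *)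
Lemma cvg_L2_sqdist D (gs : nat -> R * R -> R) g :
  measurable (D : set mplane) -> (forall m, L2 D (gs m)) ->
  (forall m, (sqdist mu (D : set mplane) (gs m) g <= (m.+1%:R^-1 ^+ 2)%:E)%E) ->
  cvg_L2 D gs g.
Proof.
move=> mD gsL gsg; split => //.
have E m : Lnorm mu 2%:E (EFin \o ((gs m \- g) \_ D : mplane -> R))
    = ((sqdist mu (D : set mplane) (gs m) g) `^ 2^-1)%E.
  rewrite Lnorm2_restrict//; congr (_ `^ _)%E.
  by apply: eq_integral => x _; rewrite subr0.
apply: (@squeeze_cvge _ _ _ _ (fun=> 0%E) _ (fun m => (m.+1%:R^-1)%:E)).
- apply: nearW => m; rewrite E poweR_ge0/=.
  have -> : (m.+1%:R^-1)%:E = ((m.+1%:R^-1 ^+ 2)%:E `^ 2^-1)%E :> \bar R.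
    by rewrite poweR12_sqrt ?lee_fin ?sqr_ge0//= sqrtr_sqr ger0_norm.
  by apply: gt0_ler_poweR; rewrite ?in_itv/= ?sqdist_ge0 ?leey ?lee_fin ?sqr_ge0.
- exact: cvg_cst.
- exact: cvge_harmonic.
Qed.

Lemma enorm_le (x : R * R) : enorm x <= 2 * `|x|.
Proof.
have n0 : 0 <= `|x| by [].
rewrite -[2 * _]ger0_norm ?mulr_ge0// -sqrtr_sqr ler_sqrt ?sqr_ge0//.
have sq (t : R) : `|t| <= `|x| -> t ^+ 2 <= `|x| ^+ 2.
  by move=> h; rewrite -real_normK ?num_real// lerXn2r ?nnegrE.
have h1 : x.1 ^+ 2 <= `|x| ^+ 2 by apply: sq; rewrite {2}/Num.norm/= le_max lexx.
have h2 : x.2 ^+ 2 <= `|x| ^+ 2 by apply: sq; rewrite {2}/Num.norm/= le_max lexx orbT.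
by rewrite exprMn; have := sqr_ge0 `|x|; lra.
Qed.

Lemma set_dist_gt0 (A B : set (R * R)) : (0 < set_dist (closure A) B)%E ->
  exists2 r : R, 0 < r & forall x, A x -> r <= cdist B x.
Proof.
move=> AB; have [r r0 rAB] : exists2 r : R, 0 < r & (r%:E <= set_dist (closure A) B)%E.
  case: (set_dist _ _) AB => [r|_|//]; first by rewrite lte_fin; exists r.
  by exists 1; rewrite ?leey.
exists (Num.min 1 (r / 2)); first by rewrite lt_min ltr01 divr_gt0.
move=> x Ax; apply: cdist_lb => [|y By]; first by rewrite ge_min lexx.
rewrite ge_min; apply/orP; right; rewrite ler_pdivrMr// mulrC.
apply: le_trans (enorm_le _); rewrite -lee_fin; apply: (le_trans rAB).
apply: ereal_inf_lbound; exists x; first exact: subset_closure.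
by exists y.
Qed.

Lemma closure_norm_le D (M : R) : (forall x, D x -> `|x| <= M) ->
  forall x, closure D x -> `|x| <= M.
Proof.
move=> DM x Dx; rewrite leNgt; apply/negP => Mx.
have [y [Dy]] := Dx _ (nbhsx_ballx x (`|x| - M) ltac:(by rewrite subr_gt0)).
rewrite -ball_normE/= => xy; have := DM _ Dy.
by have := ler_distD y x 0; rewrite !subr0; move: xy; lra.
Qed.

(** The minimum brings [phi] down to [- n^-1] on [E], and the maximum lifts the
    result to [n^-1] on the boundary of [D]; away from these two sets, both
    barriers recede to infinity with [n]. *)
Definition cutoff E D (phi : R * R -> R) (n : R) (x : R * R) : R :=
  Num.max (Num.min (phi x) (n * cdist E x + (- n^-1)))
          (- n * cdist (boundary D) x + n^-1).

Lemma lip_cutoff E D phi n : lip phi -> lip (cutoff E D phi n).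
Proof.
move=> lphi; apply: lip_max; first apply: lip_min => //.
  by apply: lip_lin; [exact: lip_cdist|exact: lip_cst].
by apply: lip_lin; [exact: lip_cdist|exact: lip_cst].
Qed.

Lemma cutoff_norm_le E D phi n x : 1 <= n -> `|cutoff E D phi n x| <= `|phi x| + 1.
Proof.
move=> n1; have n0 : 0 < n by exact: lt_le_trans n1.
have nv : n^-1 <= 1 by rewrite invf_le1.
have nv0 : 0 < n^-1 by rewrite invr_gt0.
have a0 : 0 <= n * cdist E x by rewrite mulr_ge0 ?cdist_ge0// ltW.
have b0 : 0 <= n * cdist (boundary D) x by rewrite mulr_ge0 ?cdist_ge0// ltW.
rewrite /cutoff mulNr; move: (n * _) a0 (n * _) b0 (n^-1) nv nv0 => a a0 b b0 v v1 v0.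
have : - `|phi x| <= phi x <= `|phi x| by rewrite -ler_norml.
move=> /andP[h1 h2]; rewrite ler_norml /Num.max /Num.min.
by case: ifPn; case: ifPn; rewrite -?leNgt => ? ?; apply/andP; lra.
Qed.

(** The lower barrier is strongly negative on [E] when [n] is large, [E] being at
    a positive distance [d] from the boundary of [D]. *)
Lemma cutoff_le E D phi n d x : 0 < n -> E x -> d <= cdist (boundary D) x ->
  2 <= n * (n * d) -> cutoff E D phi n x <= - n^-1.
Proof.
move=> n0 Ex dx nd; rewrite /cutoff cdist_eq0// mulr0 add0r ge_max ge_min lexx orbT/=.
suff : 2 / n <= n * cdist (boundary D) x by rewrite mulNr; lra.
rewrite ler_pdivrMr//; apply: (le_trans nd).
by rewrite [leRHS]mulrC !ler_pM2l.
Qed.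

Lemma le_cutoff E D phi n x : boundary D x -> n^-1 <= cutoff E D phi n x.
Proof. by move=> Dx; rewrite /cutoff le_max (cdist_eq0 Dx) mulr0 add0r lexx orbT. Qed.

(** The pointwise limit of the cutoffs in [D], off the boundary of [E]. *)
Definition nonpos_on E phi x : R :=
  if x \in E then Num.min (phi x) 0 else phi x.

Lemma measurable_nonpos_on E D phi : open E -> lip phi ->
  measurable_fun (D : set mplane) (nonpos_on E phi : mplane -> R).
Proof.
move=> oE lphi; have mphi := lip_measurable lphi.
have -> : nonpos_on E phi = fun x => phi x + \1_E x * (Num.min (phi x) 0 - phi x).
  apply/funext => x; rewrite /nonpos_on indicE.
  by case: (x \in E); [rewrite mul1r addrC subrK|rewrite mul0r addr0].
apply: measurable_funTS; apply: measurable_funD => //; apply: measurable_funM.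
  by apply/measurable_indicP; exact: open_measurable_plane.
by apply: measurable_funB => //; exact: measurable_minr.
Qed.

Lemma cvg_cutoff E D phi x : open E -> open D -> D x -> ~ boundary E x ->
  cutoff E D phi n.+1%:R x @[n --> \oo] -->
    nonpos_on E phi x.
Proof.
move=> oE oD Dx nbE; apply/cvgrPdist_le => e e0.
have large (B : set (R * R)) (c : R) : ~ closure B x ->
    \forall n \near \oo, c <= n.+1%:R * cdist B x.
  move=> /cdist_gt0 d0; near=> n; rewrite -ler_pdivrMr//.
  by apply: (@le_trans _ _ n%:R); [near: n; exact: nbhs_infty_ger|rewrite ler_nat].
have nbD : ~ closure (boundary D) x.
  move=> /(_ D (open_nbhs_nbhs (conj oD Dx)))[y [[_ nDy] Dy]]; apply: nDy.
  by have /interior_id -> := oD.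
have nearE : \forall n \near \oo, ~ E x -> `|phi x| + 2 <= n.+1%:R * cdist E x.
  have [Ex|nEx] := pselect (E x); first by apply: nearW => n /(_ Ex).
  apply: filterS (large E (`|phi x| + 2) _) => // cEx; apply: nbE; split=> //.
  by have /interior_id -> := oE.
near=> n.
have v0 : 0 < n.+1%:R^-1 :> R by rewrite invr_gt0.
have ve : n.+1%:R^-1 <= e by apply: ltW; near: n; exact: (near_infty_natSinv_lt (PosNum e0)).
have v1 : n.+1%:R^-1 <= 1 :> R by rewrite invf_le1// ler1n.
have hD : `|phi x| + 2 <= n.+1%:R * cdist (boundary D) x.
  by near: n; exact: large.
have : - `|phi x| <= phi x <= `|phi x| by rewrite -ler_norml.
move=> /andP[h1 h2]; rewrite /cutoff /nonpos_on mulNr.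
have [/set_mem Ex|/negP nEx] := boolP (x \in E).
  rewrite (cdist_eq0 Ex) mulr0 add0r.
  move: (_ * cdist _ _) hD (n.+1%:R^-1) v0 v1 ve => b hb v v0 v1 ve.
  rewrite ler_norml /Num.max /Num.min.
  by case: ifPn; case: ifPn; case: ifPn; rewrite -?leNgt => ? ? ?; apply/andP; lra.
have hE : `|phi x| + 2 <= n.+1%:R * cdist E x.
  have : ~ E x by move=> /mem_set.
  by near: n.
move: (_ * cdist _ _) hE (_ * cdist _ _) hD (n.+1%:R^-1) v0 v1 ve => a ha b hb v v0 v1 ve.
rewrite ler_norml /Num.max /Num.min.
by case: ifPn; case: ifPn; rewrite -?leNgt => ? ?; apply/andP; lra.
Unshelve. all: by end_near. Qed.

End plane_L2.

(** * Density of the shape functions *)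

Section shape_dense.
Context {R : realType}.
Local Notation mplane := (measurableTypeR R * measurableTypeR R)%type.
Implicit Types (D E : set (R * R)) (f g : R * R -> R).
Local Notation mu := (@plane_measure R).

(** The cutoffs converge in L^2 by dominated convergence, and a single large [n]
    serves all the requirements. *)
Lemma lip_sign_constrained_approx D E (phi : R * R -> R) (e : R) :
  open D -> bounded_set D -> open E -> null_boundary E ->
  (0 < set_dist (closure E) (boundary D))%E -> lip phi -> 0 < e ->
  exists f (d : R), [/\ lip f, 0 < d /\ d <= e,
    (forall x, E x -> f x <= - d), (forall x, boundary D x -> d <= f x)
  & (sqdist mu (D : set mplane) f (nonpos_on E phi) <= e%:E)%E].
Proof.
move=> oD bD oE nullE ED lphi e0.
have mD := open_measurable_plane oD.
have muD := bounded_plane_measure bD mD.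
have [d0 d00 Ed0] := set_dist_gt0 ED.
have [B B1 phiB] : exists2 B, 0 <= B & forall x, D x -> `|phi x| <= B.
  have [M [_ Mb]] := bD; have [L L0 phiL] := lphi.
  exists (`|phi 0| + L * `|M + 1|); first by rewrite addr_ge0// mulr_ge0.
  move=> x Dx; have := phiL x 0; rewrite subr0 => h.
  have xM : `|x| <= M + 1 by apply: Mb => //; rewrite ltrDl.
  have := ler_wpM2l L0 (le_trans xM (ler_norm _)).
  by have := lerB_dist (phi x) (phi 0); lra.
set psi := nonpos_on E phi.
have mpsi : measurable_fun (D : set mplane) (psi : mplane -> R).
  exact: measurable_nonpos_on.
have psiB x : D x -> `|psi x| <= B + 1.
  move=> /phiB; rewrite /psi /nonpos_on ler_norml => /andP[h1 h2].
  rewrite ler_norml /Num.min; case: (x \in E); first case: ifPn;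
    by rewrite -?leNgt => *; apply/andP; lra.
have near_psi : \forall k \near \oo, (sqdist mu (D : set mplane)
    (cutoff E D phi k.+1%:R) psi <= e%:E)%E.
  apply: (@sqdist_dominated _ _ _ mu (D : set mplane) mD _ psi (cst (B + 1))) => //.
  - move=> k; apply: measurable_funTS; apply: lip_measurable; exact: lip_cutoff.
  - apply: le_lt_trans (@sqdist_le_cst _ _ _ mu _ mD (cst (B + 1)) (cst 0) (B + 1)
      _ _ _) _ => //.
    + by move=> x _; rewrite subr0 ger0_norm// addr_ge0.
    + by rewrite lte_mul_pinfty// ?lee_fin ?sqr_ge0.
  - move=> k x Dx; apply: le_trans (cutoff_norm_le _ _ _ _ _) _; first by rewrite ler1n.
    by rewrite lerD2r phiB.
  exists (boundary E); split.
  - apply: measurableD.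
      by apply: closed_measurable_plane; exact: closed_closure.
    by apply: open_measurable_plane; exact: open_interior.
  - exact: nullE.
  - move=> x /= h; apply: contrapT => nbE; apply: h => Dx.
    exact: cvg_cutoff.
near \oo => k.
have k0 : 0 < k.+1%:R :> R by rewrite ltr0n.
exists (cutoff E D phi k.+1%:R), k.+1%:R^-1; split.
- exact: lip_cutoff.
- split; first by rewrite invr_gt0.
  by apply: ltW; near: k; exact: (near_infty_natSinv_lt (PosNum e0)).
- move=> x Ex; apply: (cutoff_le phi k0 Ex (Ed0 _ Ex)).
  apply: (@le_trans _ _ (k.+1%:R * d0)).
    rewrite -ler_pdivrMr//; apply: (@le_trans _ _ k%:R); last by rewrite ler_nat.
    by near: k; exact: nbhs_infty_ger.
  by rewrite ler_peMl ?mulr_ge0 ?ler1n// ltW.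
- by move=> x Dx; exact: le_cutoff.
- by near: k.
Unshelve. all: by end_near. Qed.

Lemma polyfun_L2 D q : open D -> bounded_set D -> polyfun q -> L2 D q.
Proof.
move=> oD bD pq; have mD := open_measurable_plane oD.
have mq : measurable_fun (D : set mplane) (q : mplane -> R).
  by apply: measurable_funTS; apply: continuous_measurable_plane; exact: polyfun_continuous.
apply/(L2P _ mD); split; first exact/(measurable_restrictT _ _).1.
have [M [_ Mb]] := bD; have [L L0 qL] := polyfun_lip_bounded (M + 1) pq.
have qb x : D x -> `|q x - cst 0 x| <= L.
  move=> Dx; have xM : `|x| <= M + 1 by apply: Mb => //; rewrite ltrDl.
  by rewrite subr0; have [] := qL x x xM xM.
have m0 : measurable_fun (D : set mplane) (cst 0 : mplane -> R) by [].
apply: le_lt_trans (@sqdist_le_cst _ _ _ mu _ mD _ _ _ mq m0 qb) _.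
rewrite lte_mul_pinfty// ?lee_fin ?sqr_ge0//; exact: bounded_plane_measure.
Qed.

(** The sign constraints survive both uniform approximations, each of which
    costs a quarter of the margin [d]. *)
Lemma polyfun_shape_dense D E g (e : R) :
  open D -> bounded_set D -> open E -> null_boundary E -> E `<=` D ->
  (0 < set_dist (closure E) (boundary D))%E -> nonpos_L2 D E g -> 0 < e ->
  exists2 q, polyfun q /\ shape_functions D E q &
    (sqdist mu (D : set mplane) q g <= e%:E)%E.
Proof.
move=> oD bD oE nullE sED ED [/(L2P _ (open_measurable_plane oD)) [mg gfin] gneg] e0.
have mD := open_measurable_plane oD.
have muD := bounded_plane_measure bD mD.
have [m m0 muDm] : exists2 m : R, 0 <= m & mu (D : set mplane) = m%:E.
  exists (fine (mu (D : set mplane))); first exact: fine_ge0.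
  by rewrite fineK// ge0_fin_numE.
have [M M0 DM] : exists2 M : R, 0 < M & forall x, D x -> `|x| < M.
  have [M [_ Mb]] := bD; exists (`|M| + 2); first by rewrite ltr_wpDl.
  move=> x Dx; apply: (@le_lt_trans _ _ (`|M| + 1)); last by rewrite ltrD2l ltr1n.
  by apply: Mb => //; rewrite ltr_pwDr// ler_norm.
have DM' : forall x, closure D x -> `|x| <= M.
  by apply: closure_norm_le => x /DM/ltW.
pose r := Num.min 1 (e / 16 / (m + 1)).
have m1 : 0 < m + 1 by rewrite ltr_wpDl.
have e16 : 0 < e / 16 by rewrite divr_gt0.
have r0 : 0 < r by rewrite lt_min ltr01 !divr_gt0.
have rm : r ^+ 2 * m <= e / 16.
  have h1 : r <= 1 by rewrite ge_min lexx.
  have h2 : r * (m + 1) <= e / 16.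
    by rewrite -ler_pdivlMr// ge_min lexx orbT.
  by nra.
have re16 : r <= e / 16.
  rewrite ge_min; apply/orP; right; rewrite ler_pdivrMr// ler_peMr// ?lerDr//.
  exact: ltW.
have gfin' : (sqdist mu (D : set mplane) (g \_ D : mplane -> R) (cst 0%R) < +oo)%E.
  rewrite (_ : sqdist _ _ _ _ = sqdist mu (D : set mplane) g (cst 0%R))//.
  by apply: eq_integral => x xD; rewrite patchE xD.
have [phi lphi gphi] := lip_dense_L2 mD muD mg gfin' e16.
have [f [d [lf [d0 dr] fE fD fpsi]]] := lip_sign_constrained_approx oD bD oE nullE ED lphi r0.
have d4 : 0 < d / 4 by rewrite divr_gt0.
have [p pp pf] := lip_polyfun_approx lf M0 d4.
have [q pq [qp qdeg]] := polyfun_nondegenerate_approx pp M0 d4.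
have qf x : `|x| <= M -> `|q x - f x| <= d / 2.
  move=> xM; have := qp _ xM; have := pf _ xM.
  by have := ler_distD (p x) (q x) (f x); lra.
exists q.
  split => //; split.
  - exact: polyfun_Cinfty pq 2%N.
  - move=> x Ex; have := qf x (ltW (DM _ (sED _ Ex))).
    by rewrite ler_norml => /andP[_]; have := fE _ Ex; lra.
  - by move=> x /DM; exact: qdeg.
  - move=> x bx; have := qf x (DM' _ bx.1).
    by rewrite ler_norml => /andP[+ _]; have := fD _ bx; lra.
set psi := nonpos_on E phi in fpsi.
have mT h : lip h -> measurable_fun (D : set mplane) (h : mplane -> R).
  by move=> ?; apply: measurable_funTS; exact: lip_measurable.
have mq : measurable_fun (D : set mplane) (q : mplane -> R).
  by apply: measurable_funTS; apply: continuous_measurable_plane; exact: polyfun_continuous.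
have mf := mT _ lf; have mphi := mT _ lphi.
have mgD : measurable_fun (D : set mplane) (g \_ D : mplane -> R).
  exact: measurable_funTS.
have mpsi : measurable_fun (D : set mplane) (psi : mplane -> R).
  exact: measurable_nonpos_on.
(* On [E] the truncation at 0 is a contraction that fixes the values of [g]. *)
have psig : (sqdist mu (D : set mplane) psi (g \_ D : mplane -> R) <= (e / 16)%:E)%E.
  apply: le_trans gphi; rewrite [leRHS]sqdistC; apply: sqdist_ae_le => //.
  apply: filterS gneg => x gx Dx; rewrite patchE mem_set// /psi /nonpos_on.
  have [/set_mem Ex|_] := boolP (x \in E); last by rewrite distrC.
  have := gx Ex; rewrite /Num.min ler_norml.
  have := ler_norm (g x - phi x); have := ler_norm (phi x - g x); rewrite (distrC (phi x)).
  by case: ifPn; rewrite -?leNgt => *; apply/andP; lra.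
have qfd : (sqdist mu (D : set mplane) q f <= (e / 16)%:E)%E.
  have qfr x : D x -> `|q x - f x| <= r by move=> /DM/ltW/qf h; lra.
  apply: (le_trans (@sqdist_le_cst _ _ _ mu _ mD _ _ _ mq mf qfr)).
  by rewrite muDm -EFinM lee_fin.
have fpsi' : (sqdist mu (D : set mplane) f psi <= (e / 16)%:E)%E.
  by apply: (le_trans fpsi); rewrite lee_fin.
rewrite [leLHS](_ : _ = sqdist mu (D : set mplane) q (g \_ D : mplane -> R)); last first.
  by apply: eq_integral => x xD; rewrite patchE xD.
apply: (le_trans (@sqdist_triangle _ _ _ mu _ mD _ f _ mq mf mgD)).
have fg := @sqdist_triangle _ _ _ mu _ mD _ psi _ mf mpsi mgD.
(* the three errors add up to [10 / 16] of [e] *)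
apply: (@le_trans _ _ (2%:E * ((e / 16)%:E + 2%:E * ((e / 16)%:E + (e / 16)%:E))))%E.
  rewrite lee_pmul2l//; apply: leeD => //; apply: (le_trans fg).
  by rewrite lee_pmul2l//; apply: leeD.
rewrite [leLHS](_ : _ = (2 * (e / 16 + 2 * (e / 16 + e / 16)))%:E)// lee_fin; lra.
Qed.

End shape_dense.

Theorem proposition3p1 (R : realType) (D E : set (R * R))
    (hD : domain D) (hDb : bounded_set D) (hD11 : C11_boundary D)
    (hE : domain E) (hE0 : null_boundary E) (hED : E `<=` D)
    (hdist : (0 < set_dist (closure E) (boundary D))%E)
    (g : R * R -> R) (hg : nonpos_L2 D E g) :
  exists gs : nat -> R * R -> R,
    (forall m, shape_functions D E (gs m) /\ Cinfty_closure D (gs m)) /\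
    cvg_L2 D gs g.
Proof.
have [_ oD _] := hD; have [_ oE _] := hE.
have mD := open_measurable_plane oD.
have e0 m : 0 < m.+1%:R^-1 ^+ 2 :> R by rewrite exprn_gt0// invr_gt0.
have /choice[gs gsP] m : exists q, [/\ polyfun q, shape_functions D E q &
    (sqdist plane_measure (D : set (measurableTypeR R * measurableTypeR R)) q g
      <= (m.+1%:R^-1 ^+ 2)%:E)%E].
  have [q [pq sq] qg] := polyfun_shape_dense oD hDb oE hE0 hED hdist hg (e0 m).
  by exists q.
exists gs; split.
  by move=> m; have [pq sq _] := gsP m; split=> //; exact: polyfun_Cinfty.
apply: cvg_L2_sqdist => // m; last by have [] := gsP m.
have [pq _ _] := gsP m; exact: polyfun_L2.
Qed.
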